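(* Let $D$ be a bipartite tournament (an orientation of a complete bipartite graph $K_{m,n}$ with $m,n\ge1$). Then every non-trivial connected component of the $(1,2)$-step competition graph $C_{1,2}(D)$ has diameter at most three.
   Context: For vertices $x,y$ of a digraph $H$, $d_H(x,y)$ denotes the number of arcs in a shortest directed path from $x$ to $y$ in $H$ (if one exists). The $(1,2)$-step competition graph $C_{1,2}(D)$ of a digraph $D$ is the simple graph with vertex set $V(D)$ in which distinct $u,v$ are adjacent if and only if there is a vertex $w\neq u,v$ such that either $d_{D-v}(u,w)\le 1$ and $d_{D-u}(v,w)\le 2$, or $d_{D-u}(v,w)\le 1$ and $d_{D-v}(u,w)\le 2$. A component is non-trivial if it has at least two vertices. *)

(* Defs.v *)
From mathcomp Require Import all_boot.

Set Implicit Arguments.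
Unset Strict Implicit.
Unset Printing Implicit Defensive.

(* A digraph without parallel arcs on the vertex set T is an arc relation     *)
(* [e : rel T]; a simple graph is a symmetric irreflexive one.                *)

Section Graphs.
Variable T : finType.
Implicit Types (e : rel T) (S C : {set T}) (x y : T).

(* All the relations stay on T: vertices outside S become isolated, which     *)
(* does not affect distances between vertices of S.                           *)
Definition induced e S : rel T :=
  fun x y => [&& x \in S, y \in S & e x y].

Definition del_vertex e v : rel T := induced e [set~ v].

(* There is a directed path (no repeated vertex) with n arcs from x to y.     *)
Definition has_dipath e x y n : bool :=
  [exists p : n.-tuple T, [&& path e x p, last x p == y & uniq (x :: p)]].

(* The least such n, or None if y is not reachable from x. A directed path    *)
(* has fewer than #|T| arcs, so the range of n below loses nothing.           *)
Definition dist e x y : option nat :=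
  ohead [seq n <- iota 0 #|T| | has_dipath e x y n].

(* None plays the role of an infinite value.                                  *)
Definition at_most (d : option nat) k : bool :=
  if d is Some n then n <= k else false.

(* The components of e, as vertex sets; meant for symmetric e, so that        *)
(* [connect e] is an equivalence relation.                                    *)
Definition components e : {set {set T}} :=
  equivalence_partition (connect e) [set: T].

(* The diameter of the subgraph of e induced by C, None if disconnected.      *)
Definition diameter e C : option nat :=
  if [forall x in C, forall y in C, dist (induced e C) x y != None]
  then Some (\max_(x in C) \max_(y in C) odflt 0 (dist (induced e C) x y))
  else None.

(* The (1,2)-step competition graph of the digraph D.                         *)
Definition competition12 (D : rel T) : rel T := fun u v =>
  (u != v) &&
  [exists w : T,
    [&& w != u, w != v &
        (at_most (dist (del_vertex D v) u w) 1 &&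
         at_most (dist (del_vertex D u) v w) 2)
     || (at_most (dist (del_vertex D u) v w) 1 &&
         at_most (dist (del_vertex D v) u w) 2)]].

(* D orients the complete bipartite graph with nonempty parts A and ~: A:     *)
(* exactly one of the two arcs between vertices of different parts, and no    *)
(* arc inside a part.                                                         *)
Definition bipartite_tournament (D : rel T) : Prop :=
  exists A : {set T},
    [/\ 1 <= #|A|, 1 <= #|~: A|,
        forall x y, (x \in A) != (y \in A) -> D x y (+) D y x
      & forall x y, (x \in A) = (y \in A) -> ~~ D x y].

End Graphs.

(* Main.v *)
(* In a bipartite tournament, vertices of the same side are adjacent in C_{1,2}(D)
   iff they have a common out-neighbour, and vertices of opposite sides are adjacent
   iff each has an out-neighbour other than the other one: two such out-neighbours
   are joined by an arc, which supplies the path of length two. Suppose that u and v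
   are connected but at distance more than three. The absence of short walks forces
   all the arcs around u and v, up to the point where one can write down a set
   containing only one of u and v which no edge of C_{1,2}(D) leaves. *)

Require Import Defs.
From mathcomp Require Import all_boot.

Set Implicit Arguments.
Unset Strict Implicit.
Unset Printing Implicit Defensive.

(** * Bounded distances and connectivity through walks *)

Lemma at_most_distP (T : finType) (e : rel T) x y k :
  reflect (exists p, [/\ path e x p, last x p = y & size p <= k])
          (at_most (dist e x y) k).
Proof.
rewrite /dist; set s := [seq n <- _ | _]; apply: (iffP idP) => [|[p [ep y_def sz_p]]].
  case s_def: s => [|n s'] //= le_nk.
  have: n \in s by rewrite s_def mem_head.
  rewrite mem_filter => /andP[/existsP[p /and3P[ep /eqP <- _]] _].
  by exists p; rewrite size_tuple.
(* Cutting the cycles out of a walk gives a path at most as long, whose length is below [#|T|] since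
   its vertices are distinct. *)
case: (shortenP ep) y_def => p' ep' Up' sub_p' y_def.
have /andP[_ /uniq_leq_size/(_ sub_p') sz_p'] := Up'.
have s_p': size p' \in s.
  rewrite mem_filter mem_iota /= add0n; apply/andP; split.
    by apply/existsP; exists (in_tuple p'); rewrite ep' y_def eqxx.
  by have := max_card (mem (x :: p')); rewrite (card_uniqP Up').
(* The candidate lengths are increasing, so the head of [s] is the least. *)
have: sorted leq s by apply/sorted_filter/iota_sorted; apply: leq_trans.
case: s s_p' => [|n s] //= s_p' s_sorted.
have le_n: n <= size p'.
  move: s_p'; rewrite inE => /predU1P[-> //|].
  by move: s_sorted; rewrite (path_sortedE leq_trans) => /andP[/allP le_s _] /le_s.
exact: leq_trans le_n (leq_trans sz_p' sz_p).
Qed.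

Lemma at_most_dist_sym (T : finType) (e : rel T) x y k :
  symmetric e -> at_most (dist e x y) k = at_most (dist e y x) k.
Proof.
move=> e_sym; wlog suff half: x y / at_most (dist e x y) k -> at_most (dist e y x) k.
  by apply/idP/idP; apply: half.
move=> /at_most_distP[p [ep <- sz_p]]; apply/at_most_distP.
exists (rev (belast x p)); split; last by rewrite size_rev size_belast.
  by rewrite rev_path; apply: sub_path ep => ? ?; rewrite e_sym.
by case: p {ep sz_p} => //= z p; rewrite rev_cons last_rcons.
Qed.

(** Some walk leads from [x] to [y], and its first step out of [S] is the required edge. The
    contradictions below come from examining such an edge. *)
Lemma connect_exit (T : finType) (e : rel T) (S : pred T) x y :
  connect e x y -> S x -> ~~ S y -> exists s t, [/\ S s, ~~ S t & e s t].
Proof.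
case/connectP=> p; elim: p x => [|z p IHp] x /= => [_ -> -> //|].
case/andP=> exz ep y_def Sx Sy; have [Sz|Sz] := boolP (S z); last by exists x, z.
exact: IHp ep y_def Sz Sy.
Qed.

(** * Adjacency in the competition graph of a bipartite tournament *)

Section CompetitionGraph.
Variables (T : finType) (D : rel T).
Local Notation G := (competition12 D).

Lemma competition12_sym : symmetric G.
Proof.
move=> u v; rewrite /competition12 eq_sym; congr (_ && _).
by apply: eq_existsb => w; rewrite orbC andbCA.
Qed.

Lemma del_vertex_dist1 v u w : w != u ->
  at_most (dist (del_vertex D v) u w) 1 -> [/\ u != v, w != v & D u w].
Proof.
move=> wNu /at_most_distP[] [|a [|b p]] [] //=.
  by move=> _ uw; rewrite uw eqxx in wNu.
by rewrite andbT /del_vertex /induced !inE => /and3P[] ? ? ? <-.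
Qed.

Lemma del_vertex_dist2 v u w : w != u ->
  at_most (dist (del_vertex D v) u w) 2 ->
  D u w \/ exists2 a, a != v & D u a && D a w.
Proof.
move=> wNu /at_most_distP[] [|a [|b [|d p]]] [] //=.
- by move=> _ uw; rewrite uw eqxx in wNu.
- by rewrite andbT => /and3P[_ _ uv] <- _; left.
rewrite andbT /del_vertex /induced !inE.
by move=> /andP[/and3P[_ aNv ua] /and3P[_ _ ab]] <- _; right; exists a; rewrite ?ua.
Qed.

Lemma dist1_del_vertex v u w : u != v -> w != v -> D u w ->
  forall k, 0 < k -> at_most (dist (del_vertex D v) u w) k.
Proof.
move=> uNv wNv uw k k_gt0; apply/at_most_distP; exists [:: w].
by rewrite /= /del_vertex /induced !inE uNv wNv uw.
Qed.

Lemma dist2_del_vertex v u a w : u != v -> a != v -> w != v -> D u a -> D a w ->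
  at_most (dist (del_vertex D v) u w) 2.
Proof.
move=> uNv aNv wNv ua aw; apply/at_most_distP; exists [:: a; w].
by rewrite /= /del_vertex /induced !inE uNv aNv wNv ua aw.
Qed.

Variable c : T -> bool.
Hypothesis arc_total : forall x y, c x != c y -> D x y (+) D y x.
Hypothesis arc_cross : forall x y, c x = c y -> ~~ D x y.

Lemma arc_side x y : D x y -> c y = ~~ c x.
Proof.
by move=> xy; have := @arc_cross x y; rewrite xy; case: (c x) (c y) => [] [] // /(_ erefl).
Qed.

Lemma arc_asym x y : D x y -> ~ D y x.
Proof.
move=> xy yx; have := @arc_total x y.
by rewrite (arc_side xy) xy yx; case: (c x) => /(_ isT).
Qed.

Lemma arc_or x y : c y = ~~ c x -> D x y \/ D y x.
Proof.
move=> xy; have /arc_total: c x != c y by rewrite xy; case: (c x).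
by case: (D x y); [left | right].
Qed.

Lemma side_or x y : c y = c x \/ c y = ~~ c x.
Proof. by case: (c x) (c y) => [] []; [left | right | right | left]. Qed.

(* Decides goals that follow from arcs switching sides and having no opposite,
   possibly after substituting an equality to be refuted. *)
Ltac arcs :=
  try (apply/eqP => ?; subst); try (apply/negP => ?);
  repeat match goal with
         | H : is_true (D _ _) |- _ => move: H (arc_asym H) (arc_side H)
         end;
  repeat match goal with
         | H : c _ = _ |- _ => move: H
         | H : is_true (?x != ?x) |- _ => by rewrite eqxx in H
         end;
  repeat match goal with |- context [c ?x] => case: (c x) end;
  by move=> *; try discriminate; try contradiction.

Lemma competition12_same u v w :
  c v = c u -> u != v -> D u w -> D v w -> G u v.
Proof.
move=> uv uNv uw vw; have wNu: w != u by arcs.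
have wNv: w != v by arcs.
rewrite /competition12 uNv; apply/existsP; exists w; rewrite wNu wNv /=.
by rewrite !dist1_del_vertex // eq_sym.
Qed.

Lemma competition12_cross u v w z :
  c v = ~~ c u -> D u w -> w != v -> D v z -> z != u -> G u v.
Proof.
move=> uv uw wNv vz zNu; have uNv: u != v by arcs.
have wNu: w != u by arcs.
have zNv: z != v by arcs.
have vNu: v != u by rewrite eq_sym.
(* The head of the arc between [w] and [z] is the common target: one of [u] and [v] reaches it by an
   arc, the other in two steps. *)
have /arc_or wz: c z = ~~ c w by arcs.
rewrite /competition12 uNv; apply/existsP; case: wz => [wz|zw].
  exists z; rewrite zNu zNv /= orbC.
  by rewrite (dist1_del_vertex vNu) // (dist2_del_vertex uNv wNv _ uw).
exists w; rewrite wNu wNv /=.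
by rewrite (dist1_del_vertex uNv) // (dist2_del_vertex vNu zNu _ vz).
Qed.

(** An arc changes sides and a path of two arcs does not, so both vertices reach the common target
    by one arc. *)
Lemma competition12_sameP u v :
  c v = c u -> G u v -> exists w, D u w /\ D v w.
Proof.
move=> uv /andP[_ /existsP[w /and3P[wNu wNv]]].
case/orP=> /andP[/(del_vertex_dist1 _)-/(_ ltac:(by []))[_ _ H1]];
  case/(del_vertex_dist2 _)=> // [H2 | [a _ /andP[va aw]]]; try by exists w.
- by exfalso; arcs.
- by exfalso; arcs.
Qed.

(** By parity, exactly one of the two vertices needs two arcs to reach the target; its intermediate
    vertex and the target are the two witnesses. *)
Lemma competition12_crossP u v : c v = ~~ c u -> G u v ->
  (exists2 w, D u w & w != v) /\ (exists2 z, D v z & z != u).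
Proof.
move=> uv /andP[_ /existsP[w /and3P[wNu wNv]]].
case/orP=> /andP[/(del_vertex_dist1 _)-/(_ ltac:(by []))[_ _ H1]];
  case/(del_vertex_dist2 _)=> // [H2 | [a aN /andP[va aw]]].
- by exfalso; arcs.
- by split; [exists w | exists a].
- by exfalso; arcs.
- by split; [exists a | exists w].
Qed.

(** * Short walks, and connected vertices on opposite sides *)

Local Notation near u v := (at_most (dist G u v) 3).

Lemma near1 u v : G u v -> near u v.
Proof. by move=> uv; apply/at_most_distP; exists [:: v]; rewrite /= uv. Qed.

Lemma near2 u x v : G u x -> G x v -> near u v.
Proof. by move=> ux xv; apply/at_most_distP; exists [:: x; v]; rewrite /= ux xv. Qed.

Lemma near3 u x y v : G u x -> G x y -> G y v -> near u v.
Proof.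
by move=> ux xy yv; apply/at_most_distP; exists [:: x; y; v]; rewrite /= ux xy yv.
Qed.

Lemma connect_nbr u v : u != v -> connect G u v -> exists y, G u y.
Proof.
move=> uNv uGv; have vNu: ~~ pred1 u v by rewrite /= eq_sym.
by have [s [t [/eqP <- _ st]]] := connect_exit (S := pred1 u) uGv (eqxx u) vNu; exists t.
Qed.

Lemma competition12_out u y : G u y -> exists w, D u w.
Proof.
move=> uy; case: (side_or u y) => yu.
  by have [w [uw _]] := competition12_sameP yu uy; exists w.
by have [[w uw _] _] := competition12_crossP yu uy; exists w.
Qed.

Lemma near_cross u v : c v = ~~ c u -> D u v -> (forall w, D u w -> w = v) ->
  connect G u v -> near u v.
Proof.
move=> uv Duv outu uGv; apply: contraT => far.
have uNv: u != v by arcs.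
have [x ux] := connect_nbr uNv uGv.
have [y vy]: exists y, G v y.
  apply: (connect_nbr (v := u)); rewrite 1?eq_sym //.
  by rewrite (sym_connect_sym competition12_sym).
have [q vq] := competition12_out vy.
(* A second out-neighbour of [a] would make [a] adjacent to [v], while [v] as a common out-neighbour
   makes it adjacent to [u]. *)
have outP a w : D a v -> D a w -> w = v.
  move=> av aw; have [aEu | aNu] := eqVneq a u; first by apply: outu; rewrite -aEu.
  apply: contraNeq far => wNv; apply: (near2 (x := a)).
    by apply: (competition12_same (w := v)); first arcs; rewrite 1?eq_sym.
  by apply: (competition12_cross (w := w) (z := q)) => //; arcs.
(* Otherwise [b] has an arc to [u], whose only out-neighbour is [v], and [b] is adjacent to both [u]
   and [v]. *)
have outB b r : D b r -> D v r -> b = v.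
  move=> br vr; apply: contraNeq far => bNv.
  have bu: D b u.
    have [] // : D b u \/ D u b by apply: arc_or; arcs.
    by move/outu=> bv; rewrite bv eqxx in bNv.
  apply: (near2 (x := b)).
    by apply: (competition12_cross (w := v) (z := r)) => //; first [by rewrite eq_sym | arcs].
  by apply: (competition12_same (w := r)) => //; arcs.
(* An edge leaving [S] contradicts [outP] or [outB], unless it goes from the side of [v] to an
   out-neighbour of [v]; in that case [u], [s], [t], [v] is a walk. *)
pose S a := D a v || (c a == c v) && (a != v).
have Su: S u by rewrite /S Duv.
have NSv: ~~ S v by rewrite /S !eqxx orbF; arcs.
have [s [t [Ss NSt st]]] := connect_exit uGv Su NSv.
have {NSt} tP: t = v \/ c t = c u /\ D v t.
  move: NSt; rewrite negb_or => /andP[tv]; have [-> | tNv] := eqVneq t v; first by left.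
  rewrite andbT => /eqP tc; right; have tu: c t = c u by move: tc uv; case: (c t) (c v) (c u) => [] [] [].
  by split=> //; have [] // : D v t \/ D t v; [apply: arc_or; arcs | rewrite (negPf tv)].
case/orP: Ss => [sv | /andP[/eqP sc sNv]]; case: tP => [tE | [tc vt]].
- rewrite {t}tE in st; have [[w sw wNv] _] := competition12_crossP (arc_side sv) st.
  by rewrite (outP s w) ?eqxx in wNv.
- have [|w [sw tw]] := competition12_sameP _ st; first by arcs.
  by rewrite (outP s w) // in tw; exfalso; arcs.
- rewrite {t}tE in st; have [|w [sw vw]] := competition12_sameP _ st; first by [].
  by rewrite (outB s w) ?eqxx in sNv.
have DsP a : D a v -> D s a.
  move=> av; have [] // : D s a \/ D a s by apply: arc_or; arcs.
  by move/(outP _ _ av)=> sv; rewrite sv eqxx in sNv.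
(* By [DsP], [p] is an out-neighbour of [s] other than [u], as the edge from [u] to [s] requires. *)
have [p pv pNu]: exists2 p, D p v & p != u.
  case: (side_or u x) => xu.
    have [w [uw xw]] := competition12_sameP xu ux; rewrite (outu w uw) in xw.
    by exists x => //; case/andP: ux; rewrite eq_sym.
  have [[w uw wNx] [z xz zNu]] := competition12_crossP xu ux.
  exists z => //; have [] // : D z v \/ D v z by apply: arc_or; arcs.
  by move/(outB _ _ xz)=> xv; rewrite xv (outu w uw) eqxx in wNx.
(* The edge from [t] to [v] requires an out-neighbour of [v] other than [t]. *)
have [r vr rNt]: exists2 r, D v r & r != t.
  case: (side_or v y) => yv.
    have [w [vw yw]] := competition12_sameP yv vy.
    by case/andP: vy; rewrite (outB y w) // eqxx.
  have [[w vw wNy] [z yz zNv]] := competition12_crossP yv vy.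
  have [tE | ] := eqVneq w t; last by exists w.
  exists y; last by rewrite -tE eq_sym.
  have [] // : D v y \/ D y v by apply: arc_or.
  by move/outP/(_ yz)=> zv; rewrite zv eqxx in zNv.
apply: contraNT far => _; apply: (near3 (x := s) (y := t)) => //.
  apply: (competition12_cross (w := v) (z := p)) => //; first by arcs.
    by rewrite eq_sym.
  exact: DsP.
have [|[w sw _] [z tz zNs]] := competition12_crossP _ st; first by arcs.
by apply: (competition12_cross (w := z) (z := r)) => //; arcs.
Qed.

(** * Connected vertices on the same side *)

Lemma near_sym u v : near u v = near v u.
Proof. exact: at_most_dist_sym competition12_sym. Qed.

(* A vertex of the other side outside both out-neighbourhoods dominates [u] and [v],
   hence is adjacent to both. *)
Lemma far_cover u v p q b : c v = c u -> u != v -> ~~ near u v ->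
  D u p -> D v q -> c b = ~~ c u -> D u b \/ D v b.
Proof.
move=> vu uNv far up vq bu; have [ub | bu'] : D u b \/ D b u by apply: arc_or.
  by left.
have [|vb | bv] := @arc_or v b; [by arcs | by right | exfalso].
move/negP: far; apply; apply: (near2 (x := b)).
  by apply: (competition12_cross (w := p) (z := v)); rewrite // 1?eq_sym //; arcs.
by apply: (competition12_cross (w := u) (z := q)) => //; arcs.
Qed.

Lemma far_common u v w : c v = c u -> u != v -> ~~ near u v -> D u w -> D v w -> False.
Proof. by move=> vu uNv /negP far uw vw; apply/far/near1/(competition12_same _ _ uw vw). Qed.

(** If [a] is neither [u] nor [v], it is adjacent to both; if it is one of them, [u] and [v] share
    an out-neighbour. *)
Lemma far_hit u v a w z : c v = c u -> u != v -> ~~ near u v -> c a = c u ->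
  D u w -> D a w -> D v z -> D a z -> False.
Proof.
move=> vu uNv far au uw aw vz az.
have [aE | aNu] := eqVneq a u; first by rewrite aE in az; apply: (far_common _ _ far az vz).
have [aE | aNv] := eqVneq a v; first by rewrite aE in aw; apply: (far_common _ _ far uw aw).
move/negP: far; apply; apply: (near2 (x := a)).
  by apply: (competition12_same (w := w)); rewrite // eq_sym.
by apply: (competition12_same (w := z)) => //; arcs.
Qed.

(** Since [u] and [v] share no out-neighbour, [r] has an arc to [v]. One of [p] and [p2] differs
    from [r], so [u] and [r] are adjacent; a second out-neighbour of [r] would make [r] adjacent to
    [v] too. *)
Lemma far_out2 u v p p2 q : c v = c u -> u != v -> ~~ near u v ->
  D u p -> D u p2 -> p != p2 -> D v q ->
  forall r w, D u r -> D r w -> w = v.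
Proof.
move=> vu uNv far up up2 pNp2 vq r w ur rw; have vNu: v != u by rewrite eq_sym.
have rv: D r v.
  have [] // : D r v \/ D v r by apply: arc_or; arcs.
  by move=> vr; case: (far_common vu uNv far ur vr).
apply: contraNeq far => wNv; apply: (near2 (x := r)).
  have [pr | pNr] := eqVneq p r.
    by apply: (competition12_cross (w := p2) (z := v)); rewrite // -?pr ?(eq_sym p2) // pr; arcs.
  by apply: (competition12_cross (w := p) (z := v)) => //; arcs.
by apply: (competition12_cross (w := w) (z := q)) => //; arcs.
Qed.

Lemma near_same2 u v p p2 : c v = c u -> u != v -> D u p -> D u p2 -> p != p2 ->
  connect G u v -> near u v.
Proof.
move=> vu uNv up up2 pNp2 uGv; apply: contraT => far.
have vNu: v != u by rewrite eq_sym.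
have vGu: connect G v u by rewrite (sym_connect_sym competition12_sym).
have [y vy] := connect_nbr vNu vGu.
have [q0 vq0] := competition12_out vy.
have outP := far_out2 vu uNv far up up2 pNp2 vq0.
have hitQ a q : c a = c u -> D v q -> D a q -> a = v.
  move=> au vq aq; have [pa | ap] : D p a \/ D a p by apply: arc_or; arcs.
    exact: outP pa.
  by case: (far_hit vu uNv far au up ap vq aq).
have cover b : c b = ~~ c u -> D u b \/ D v b by exact: far_cover up vq0.
(* The neighbour [y] forces a second out-neighbour of [v], so [far_out2] also applies with [u] and
   [v] exchanged. *)
have [q [q2 [vq vq2 qNq2]]]: exists q, exists q2, [/\ D v q, D v q2 & q != q2].
  case: (side_or v y) => yv.
    have [w [vw yw]] := competition12_sameP yv vy.
    by case/andP: vy; rewrite (hitQ y w) ?eqxx // yv.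
  have [[w vw wNy] [z yz zNv]] := competition12_crossP yv vy.
  have [|uy|vy'] := cover y; first by arcs.
    by rewrite (outP y z) ?eqxx in zNv.
  by exists w, y.
have outQ: forall r w, D v r -> D r w -> w = u.
  by apply: (far_out2 _ vNu _ vq vq2 qNq2 up); rewrite // near_sym.
(* No edge leaves the set formed by [v] and its out-neighbours: by [cover], a vertex [t] of the
   other side outside it is an out-neighbour of [u], hence has no out-neighbour but [v]. *)
pose S a := (a == v) || D v a.
have Sv: S v by rewrite /S eqxx.
have NSu: ~~ S u by rewrite /S negb_or uNv; arcs.
have [s [t [Ss]]] := connect_exit vGu Sv NSu.
rewrite negb_or => /andP[tNv Nvt] st; case/predU1P: Ss => [sE | vs].
  rewrite {s}sE in st; case: (side_or v t) => tv.
    have [w [vw tw]] := competition12_sameP tv st.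
    by rewrite (hitQ t w) ?eqxx // ?tv in tNv.
  have [_ [z tz zNv]] := competition12_crossP tv st.
  have [|ut|vt] := cover t; [by arcs | | by rewrite vt in Nvt].
  by rewrite (outP t z) ?eqxx in zNv.
case: (side_or s t) => ts.
  have [w [sw tw]] := competition12_sameP ts st.
  have [|ut|vt] := cover t; [by arcs | | by rewrite vt in Nvt].
  by rewrite -(outQ s w) // (outP t w) // eqxx in uNv.
have [[w sw wNt] _] := competition12_crossP ts st.
have [s_t | t_s] : D s t \/ D t s by apply: arc_or.
  by rewrite (outQ s w) // (outQ s t) // eqxx in wNt.
by rewrite (hitQ t s) ?eqxx // in tNv; arcs.
Qed.

(** If [u] and [v] are far apart, [far_cover] reduces the opposite side to [p] and [q], which leaves
    few possible edges. *)
Lemma near_same1 u v p q : c v = c u -> u != v -> D u p -> D v q ->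
  (forall w, D u w -> w = p) -> (forall w, D v w -> w = q) ->
  connect G u v -> near u v.
Proof.
move=> vu uNv up vq outu outv uGv; apply: contraT => far.
have vNu: v != u by rewrite eq_sym.
have pNq: p != q.
  by apply/eqP=> pq; rewrite -pq in vq; apply: (far_common vu uNv far up vq).
have cover b : c b = ~~ c u -> b = p \/ b = q.
  by move=> bu; case: (far_cover vu uNv far up vq bu) => [/outu | /outv]; [left | right].
(* A common out-neighbour of [p] and [q] would give the walk [u], [q], [p], [v]. *)
have noZ a : D p a -> D q a -> False.
  move=> pa qa; move/negP: far; apply.
  have aNu: a != u by apply/eqP=> au; rewrite au in pa; arcs.
  have aNv: a != v by apply/eqP=> av; rewrite av in qa; arcs.
  apply: (near3 (x := q) (y := p)).
  - by apply: (competition12_cross (w := p) (z := a)) => //; arcs.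
  - by apply: (competition12_same (w := a)); rewrite // 1?eq_sym //; arcs.
  - by apply: (competition12_cross (w := a) (z := q)); rewrite // 1?eq_sym //; arcs.
have hit a : D a p -> D a q -> False.
  by move=> ap aq; apply: (far_hit vu uNv far _ up ap vq aq); arcs.
(* With [noZ] and [hit], no edge leaves the set formed by [q] and the in-neighbours of [p]. *)
pose S a := D a p || (a == q).
have Su: S u by rewrite /S up.
have NSv: ~~ S v.
  rewrite negb_or; apply/andP; split; last by arcs.
  by apply/negP=> /(far_common vu uNv far up).
have [s [t [Ss]]] := connect_exit uGv Su NSv.
rewrite negb_or => /andP[/negP Ntp tNq] st.
case/orP: Ss => [sp | /eqP sE].
  case: (side_or s t) => ts.
    have [w [sw tw]] := competition12_sameP ts st.
    have [|wp|wq] := cover w; first by arcs.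
      by rewrite wp in tw.
    by case: (hit s); rewrite -?wq.
  have [[w sw wNt] _] := competition12_crossP ts st.
  have [|tp|tq] := cover t; [by arcs | | by rewrite tq eqxx in tNq].
  have [|wp|wq] := cover w; [by arcs | by rewrite wp tp eqxx in wNt |].
  by case: (hit s); rewrite -?wq.
rewrite {s}sE in st; case: (side_or q t) => tq.
  have [w [qw tw]] := competition12_sameP tq st.
  have [|tp|tq'] := cover t; [by arcs | | by rewrite tq' eqxx in tNq].
  by case: (noZ w); rewrite // -tp.
have [_ [z tz zNq]] := competition12_crossP tq st.
by have [|zp|zq] := cover z; [arcs | rewrite zp in tz | rewrite zq eqxx in zNq].
Qed.

(** * From the cases to the components *)

Lemma near_connect u v : connect G u v -> near u v.
Proof.
move=> uGv; have [<- | uNv] := eqVneq u v; first by apply/at_most_distP; exists [::].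
have vNu: v != u by rewrite eq_sym.
have vGu: connect G v u by rewrite (sym_connect_sym competition12_sym).
have [x /competition12_out[p up]] := connect_nbr uNv uGv.
have [y /competition12_out[q vq]] := connect_nbr vNu vGu.
case: (side_or u v) => vu.
  have [/existsP[p2 /andP[up2 p2Np]] | /existsPn outu] :=
    boolP [exists w, D u w && (w != p)].
    exact: near_same2 vu uNv up2 up p2Np uGv.
  have [/existsP[q2 /andP[vq2 q2Nq]] | /existsPn outv] :=
    boolP [exists w, D v w && (w != q)].
    by rewrite near_sym; apply: (near_same2 _ vNu vq2 vq q2Nq vGu).
  apply: (near_same1 vu uNv up vq) => // w.
    by move=> uw; have := outu w; rewrite uw negbK => /eqP.
  by move=> vw; have := outv w; rewrite vw negbK => /eqP.
(* On opposite sides, either each vertex has an out-neighbour besides the other and they are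
   adjacent, or one has the other as its only out-neighbour. *)
have [/existsP[w /andP[uw wNv]] | /existsPn outu] := boolP [exists w, D u w && (w != v)].
  have [/existsP[z /andP[vz zNu]] | /existsPn outv] := boolP [exists z, D v z && (z != u)].
    exact/near1/(competition12_cross vu uw wNv vz zNu).
  have {}outv z: D v z -> z = u by move=> vz; have := outv z; rewrite vz negbK => /eqP.
  rewrite near_sym; apply: near_cross => //; last by rewrite -(outv q vq).
  by rewrite vu negbK.
have {}outu w: D u w -> w = v by move=> uw; have := outu w; rewrite uw negbK => /eqP.
by apply: near_cross => //; rewrite -(outu p up).
Qed.

End CompetitionGraph.

(** A walk that starts in a component stays in it. *)
Lemma at_most_dist_component (T : finType) (e : rel T) (x0 x y : T) k :
  connect e x0 x -> at_most (dist e x y) k ->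
  at_most (dist (induced e [set z in [set: T] | connect e x0 z]) x y) k.
Proof.
move=> x0x /at_most_distP[p [ep py sz_p]]; apply/at_most_distP; exists p; split=> //.
elim: p x x0x ep {py sz_p} => //= z p IHp x x0x /andP[xz ep].
have x0z := connect_trans x0x (connect1 xz).
by rewrite /induced !inE x0x x0z xz IHp.
Qed.

Theorem theorem2p9 (T : finType) (D : rel T) (C : {set T}) :
  bipartite_tournament D ->
  C \in components (competition12 D) ->
  1 < #|C| ->
  at_most (diameter (competition12 D) C) 3.
Proof.
case=> A [_ _ arc_total arc_cross] /imsetP[x0 _ ->] _.
set C0 := [set y in _ | _].
have near x y : x \in C0 -> y \in C0 ->
    at_most (dist (induced (competition12 D) C0) x y) 3.
  rewrite !inE => x0x x0y; apply: at_most_dist_component => //.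
  apply: (near_connect (c := fun z => z \in A)) => //.
  by apply: connect_trans x0y; rewrite (sym_connect_sym (@competition12_sym T D)).
rewrite /diameter ifT.
  apply/bigmax_leqP => x Cx; apply/bigmax_leqP => y Cy.
  by have := near x y Cx Cy; case: (dist _ x y).
(* As [at_most] is false on [None], [near] also shows that the distances are finite. *)
apply/forall_inP=> x Cx; apply/forall_inP=> y Cy.
by have := near x y Cx Cy; case: (dist _ x y).
Qed.
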